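(* Let $A$ be a commutative unital ring. The category $\mathcal W_A$ of 2-typical Witt complexes over $A$ has an initial object.
   Context: All rings are commutative and unital; graded rings are graded-commutative, i.e. $xy=(-1)^{|x||y|}yx$. For a ring $A$, $W_n(A)$ is the ring of 2-typical Witt vectors of length $n$ ($W_n(A)=0$ for $n\le 0$), with restriction $R:W_n(A)\to W_{n-1}(A)$, Frobenius $F:W_n(A)\to W_{n-1}(A)$, Verschiebung $V:W_{n}(A)\to W_{n+1}(A)$, and Teichmüller map $[a]_n=(a,0,\dots,0)$. A pro-object is a sequence $\{X_n\}_{n\in\mathbb Z}$ with maps $R:X_n\to X_{n-1}$; a strict map of pro-objects is a family of maps commuting with $R$. A 2-typical Witt complex over $A$ consists of: (i) a graded-commutative pro-graded ring $\{E_n^*,R:E_n^*\to E_{n-1}^*\}_{n\in\mathbb Z}$ with $E_n^*=0$ for $n\le0$; (ii) a strict map of pro-rings $\lambda:W_\bullet(A)\to E^0_\bullet$; (iii) a strict map of pro-graded rings $F:E^*_\bullet\to E^*_{\bullet-1}$ with $\lambda F=F\lambda$; (iv) a strict map of pro-graded abelian groups $V:E^*_\bullet\to E^*_{\bullet+1}$ with $V(x)y=V(xF(y))$, $\lambda V=V\lambda$ and $FV=2$; (v) a strict map of pro-graded abelian groups $d:E^*_\bullet\to E^{*+1}_\bullet$ with $d(xy)=d(x)y+(-1)^{|x|}x\,d(y)$. Let $\iota:E_n^*\to E_n^{*+1}$ be multiplication by $\frac{d\lambda[-1]_n}{\lambda[-1]_n}$. One requires $FdV=d+\iota$, $dd=d\iota=\iota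 d$, and $Fd\lambda([a]_n)=\lambda([a]_{n-1})\,d\lambda([a]_{n-1})$ for all $a\in A$. A morphism of Witt complexes is a map of pro-graded rings commuting with $\lambda,d,F,V$. *)

(* Defs.v *)
From HB Require Import structures.
From mathcomp Require Import all_boot all_order all_algebra.
From mathcomp Require Import mpoly.

Set Implicit Arguments.
Unset Strict Implicit.
Unset Printing Implicit Defensive.

Import GRing.Theory.
Local Open Scope ring_scope.

(* The zero ring is allowed, whereas [mmap] and [meval] need a nonzero target
   ring; this evaluates an integer polynomial at X_i := v`_i in any
   commutative ring. *)
Definition peval (A : comPzRingType) (N : nat) (v : seq A)
    (p : {mpoly int[N]}) : A :=
  \sum_(m <- msupp p) (\prod_(i < N) v`_i ^+ m i) *~ p@_m.

Section PEval.
Variables (A : comPzRingType) (N : nat) (v : seq A).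

Lemma pevalE (B : comNzRingType) (w : seq B) (p : {mpoly int[N]}) :
  peval w p = mmap intr (fun i : 'I_N => w`_i) p.
Proof. by rewrite /peval /mmap; apply: eq_bigr => m _; rewrite mulrzl. Qed.

Lemma peval_morph_nz (B : comNzRingType) (w : seq B) :
  zmod_morphism (@peval B N w) * monoid_morphism (@peval B N w).
Proof.
split; [move=> p q|split=> [|p q]]; rewrite !pevalE.
- exact: rmorphB.
- exact: rmorph1.
- exact: rmorphM.
Qed.

Lemma peval_morph :
  zmod_morphism (@peval A N v) * monoid_morphism (@peval A N v).
Proof.
have [A0|A1] := eqVneq (1 : A) 0.
  have A00 (x y : A) : x = y by rewrite -[x]mul1r -[y]mul1r A0 !mul0r.
  by split; [move=> p q|split=> [|p q]]; apply: A00.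
pose B : comNzRingType := HB.pack A (GRing.PzSemiRing_isNonZero.Build A A1).
exact: (@peval_morph_nz B v).
Qed.

HB.instance Definition _ :=
  GRing.isZmodMorphism.Build {mpoly int[N]} A (@peval A N v) peval_morph.1.
HB.instance Definition _ :=
  GRing.isMonoidMorphism.Build {mpoly int[N]} A (@peval A N v) peval_morph.2.

Lemma pevalX (i : 'I_N) : peval v 'X_i = v`_i.
Proof.
rewrite /peval msuppX big_seq1 mcoeffX eqxx mulr1z (bigD1 i) //=.
rewrite mnm1E eqxx expr1 big1 ?mulr1 // => j ji.
by rewrite mnm1E eq_sym (negPf ji) expr0.
Qed.

End PEval.

Section Ghost.

(* k-th ghost component; entries beyond the length of x count as 0. *)
Definition ghost (B : pzSemiRingType) (x : seq B) (k : nat) : B :=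
  \sum_(i < k.+1) x`_i ^+ (2 ^ (k - i)) *+ 2 ^ i.

Lemma ghost_map (B C : pzSemiRingType) (f : {rmorphism B -> C}) (x : seq B) k :
  ghost (map f x) k = f (ghost x k).
Proof.
rewrite /ghost rmorph_sum; apply: eq_bigr => i _.
rewrite rmorphMn rmorphXn /=; congr (_ ^+ _ *+ _).
have [ix|ix] := ltnP i (size x); first by rewrite (nth_map 0).
by rewrite !nth_default ?rmorph0 ?size_map.
Qed.

Lemma ghost_rec (B : pzSemiRingType) (x : seq B) k : ghost x k.+1 =
  \sum_(i < k.+1) x`_i ^+ (2 ^ (k - i)).*2 *+ 2 ^ i + x`_k.+1 *+ 2 ^ k.+1.
Proof.
rewrite {1}/ghost big_ord_recr /= subnn expr1; congr (_ + _).
by apply: eq_bigr => i _; rewrite subSn -1?ltnS // expnS mul2n.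
Qed.

Lemma eq_ghost (B : pzSemiRingType) (x y : seq B) k :
  (forall i, (i <= k)%N -> x`_i = y`_i) -> ghost x k = ghost y k.
Proof. by move=> xy; apply: eq_bigr => i _; rewrite xy // -ltnS. Qed.

Variable N : nat.
Local Notation P := {mpoly int[N]}.

Lemma mpoly_mulrnI (m : nat) : (0 < m)%N -> injective (fun p : P => p *+ m).
Proof.
move=> m0 p q /mpolyP pq; apply/mpolyP => u; move: (pq u).
by rewrite !mcoeffMn; apply: Num.Theory.pmulrnI.
Qed.

Lemma ghost_inj n (s t : n.-tuple P) :
  (forall k, (k < n)%N -> ghost s k = ghost t k) -> s = t.
Proof.
move=> st; apply: eq_from_tnth => i; rewrite !(tnth_nth 0).
elim/ltn_ind: {i}(i : nat) (ltn_ord i) => k IH kn.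
have := st k kn; rewrite /ghost !big_ord_recr /= subnn !expr1.
rewrite (eq_bigr (fun i : 'I_k => t`_i ^+ (2 ^ (k - i)) *+ 2 ^ i)).
  by move/addrI; apply: mpoly_mulrnI; rewrite expn_gt0.
by move=> i _; rewrite IH // (ltn_trans _ kn).
Qed.

Definition congr2 k (p q : P) := exists r : P, p = q + r *+ 2 ^ k.

Lemma congr2_refl k p : congr2 k p p.
Proof. by exists 0; rewrite mul0rn addr0. Qed.

Lemma congr2D k p q p' q' :
  congr2 k p q -> congr2 k p' q' -> congr2 k (p + p') (q + q').
Proof. by move=> [r ->] [r' ->]; exists (r + r'); rewrite mulrnDl addrACA. Qed.

Lemma congr2N k p q : congr2 k p q -> congr2 k (- p) (- q).
Proof. by move=> [r ->]; exists (- r); rewrite opprD mulNrn. Qed.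

Lemma congr2M k p q p' q' :
  congr2 k p q -> congr2 k p' q' -> congr2 k (p * p') (q * q').
Proof.
move=> [r ->] [r' ->]; exists (r * q' + (q + r *+ 2 ^ k) * r').
by rewrite mulrnDl -mulrnAl -mulrnAr addrA -mulrDl -mulrDr.
Qed.

Lemma congr2_trans k p q r : congr2 k p q -> congr2 k q r -> congr2 k p r.
Proof. by move=> [a ->] [b ->]; exists (b + a); rewrite mulrnDl addrA. Qed.

Lemma congr2_sum k n (f g : 'I_n -> P) :
  (forall i, congr2 k (f i) (g i)) ->
  congr2 k (\sum_(i < n) f i) (\sum_(i < n) g i).
Proof.
move=> fg; apply: (big_ind2 (congr2 k)) => //; first exact: congr2_refl.
by move=> *; apply: congr2D.
Qed.

Lemma congr2_sqr k p q : congr2 k.+1 p q -> congr2 k.+2 (p ^+ 2) (q ^+ 2).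
Proof.
move=> [r ->]; exists (q * r + (r ^+ 2) *+ 2 ^ k).
rewrite sqrrD -addrA; congr (_ + _); rewrite mulrnDl; congr (_ + _).
  by rewrite mulrnAr -mulrnA -expnSr.
rewrite exprMn_n -mulrnA -expnM -expnD; congr (_ *+ 2 ^ _).
by rewrite muln2 -addnn !addnS addSn.
Qed.

Lemma congr2_exp k j p q :
  congr2 k.+1 p q -> congr2 (j + k).+1 (p ^+ (2 ^ j)) (q ^+ (2 ^ j)).
Proof.
move=> pq; elim: j => [|j IH]; first by rewrite !expr1.
by rewrite expnSr !exprM addSn; apply: congr2_sqr.
Qed.

Lemma congr2_Mn i k p q :
  congr2 k p q -> congr2 (k + i) (p *+ 2 ^ i) (q *+ 2 ^ i).
Proof. by move=> [r ->]; exists r; rewrite mulrnDl -mulrnA -expnD. Qed.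

(* Lift of Frobenius: X_i |-> X_i ^ 2. *)
Definition frob_lift : {rmorphism P -> P} := peval [seq 'X_i ^+ 2 | i : 'I_N].

Lemma frob_liftX (i : 'I_N) : frob_lift 'X_i = 'X_i ^+ 2.
Proof.
by rewrite [LHS]pevalX (nth_map i) ?size_enum_ord // nth_ord_enum.
Qed.

Lemma frob_lift_congr p : congr2 1 (frob_lift p) (p ^+ 2).
Proof.
pose Q q := congr2 1 (frob_lift q) (q ^+ 2).
have QD a b : Q a -> Q b -> Q (a + b).
  move=> Qa Qb; rewrite /Q rmorphD; apply: congr2_trans (congr2D Qa Qb) _.
  by exists (- (a * b)); rewrite expn1 sqrrD mulNrn addrAC addrK.
have QM a b : Q a -> Q b -> Q (a * b).
  by move=> Qa Qb; rewrite /Q rmorphM exprMn; apply: congr2M.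
have Q0 : Q 0 by rewrite /Q rmorph0 expr0n; apply: congr2_refl.
have Q1 : Q 1 by rewrite /Q rmorph1 expr1n; apply: congr2_refl.
have QN a : Q a -> Q (- a).
  move=> Qa; rewrite /Q rmorphN sqrrN; apply: congr2_trans (congr2N Qa) _.
  by exists (- a ^+ 2); rewrite expn1 mulNrn mulr2n opprD addNKr.
have Qn n : Q n%:R by elim: n => [|n IH] //; rewrite mulrS; apply: QD.
have Qz (c : int) : Q c%:~R.
  by case: c => n; [exact: Qn|rewrite NegzE mulrNz; apply: QN; exact: Qn].
elim/mpolyind: p => [|c m p _ _ IH] //; apply: (QD) IH.
rewrite -mul_mpolyC; apply: (QM); first by rewrite -[c]intz rmorph_int.
rewrite mpolyXE_id; apply: (big_ind Q) => // i _.
elim: (m i) => [|k IH]; first by rewrite expr0.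
by rewrite exprS; apply: QM => //; rewrite /Q frob_liftX; apply: congr2_refl.
Qed.

Lemma dwork n (Phi : nat -> P) :
  (forall k, congr2 k.+1 (Phi k.+1) (frob_lift (Phi k))) ->
  exists s : n.-tuple P, [forall k : 'I_n, ghost s k == Phi k].
Proof.
move=> Phi_congr; elim: n => [|n [s /forallP sP]].
  by exists [tuple]; apply/forallP; case.
have [r rP] : exists r : P,
    Phi n = \sum_(i < n) s`_i ^+ (2 ^ (n - i)) *+ 2 ^ i + r *+ 2 ^ n.
  case: n s sP => [|n] s sP; first by exists (Phi 0); rewrite big_ord0 add0r.
  apply: congr2_trans (Phi_congr n) _.
  have /eqP <- := sP ord_max.
  rewrite /ghost rmorph_sum; apply: congr2_sum => i.
  have le_in : (i <= n)%N by rewrite -ltnS.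
  rewrite rmorphMn rmorphXn /= subSn // expnS exprM.
  have := congr2_Mn i (congr2_exp (n - i) (frob_lift_congr s`_i)).
  by rewrite addn0 addSn subnK.
exists [tuple of rcons s r]; apply/forallP => k; apply/eqP.
have [kn|] := ltnP k n.
  rewrite -(eqP (sP (Ordinal kn))); apply: eq_ghost => i ik /=.
  by rewrite nth_rcons size_tuple (leq_ltn_trans ik kn).
move=> nk; have -> : k = n :> nat.
  by apply/eqP; rewrite eqn_leq nk -ltnS ltn_ord.
rewrite rP /ghost big_ord_recr /= subnn expr1 nth_rcons size_tuple ltnn eqxx.
by congr (_ + _); apply: eq_bigr => i _; rewrite nth_rcons size_tuple ltn_ord.
Qed.

Lemma ghost_frob_lift (x : seq P) k :
  (forall i, (i <= k)%N -> frob_lift x`_i = x`_i ^+ 2) ->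
  congr2 k.+1 (ghost x k.+1) (frob_lift (ghost x k)).
Proof.
move=> xP; exists x`_k.+1; rewrite ghost_rec /ghost rmorph_sum; congr (_ + _).
apply: eq_bigr => i _; rewrite rmorphMn rmorphXn /= xP -1?ltnS //.
by rewrite -exprM mul2n.
Qed.

End Ghost.
Arguments frob_lift {N}.
Arguments dwork {N n} Phi _.

Definition lvars n m : seq {mpoly int[n + m]} := [seq 'X_(lshift m i) | i : 'I_n].
Definition rvars n m : seq {mpoly int[n + m]} := [seq 'X_(rshift n i) | i : 'I_m].
Definition vars n : seq {mpoly int[n]} := [seq 'X_i | i : 'I_n].

Lemma nth_image (T : nmodType) n (f : 'I_n -> T) (i : 'I_n) : [seq f j | j : 'I_n]`_i = f i.
Proof. by rewrite (nth_map i) ?size_enum_ord // nth_ord_enum. Qed.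

Lemma image_frob N n (f : 'I_n -> {mpoly int[N]}) :
  (forall i, frob_lift (f i) = f i ^+ 2) ->
  forall k, congr2 k.+1 (ghost [seq f j | j : 'I_n] k.+1)
                  (frob_lift (ghost [seq f j | j : 'I_n] k)).
Proof.
move=> fP k; apply: ghost_frob_lift => i _.
have [lt_in|le_ni] := ltnP i n.
  by rewrite (nth_image f (Ordinal lt_in)).
by rewrite nth_default ?rmorph0 ?expr0n // size_map size_enum_ord.
Qed.

Lemma lvars_frob n m k : congr2 k.+1 (ghost (lvars n m) k.+1) (frob_lift (ghost (lvars n m) k)).
Proof. by apply: image_frob => i; exact: frob_liftX. Qed.
Lemma rvars_frob n m k : congr2 k.+1 (ghost (rvars n m) k.+1) (frob_lift (ghost (rvars n m) k)).
Proof. by apply: image_frob => i; exact: frob_liftX. Qed.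
Lemma vars_frob n k : congr2 k.+1 (ghost (vars n) k.+1) (frob_lift (ghost (vars n) k)).
Proof. by apply: image_frob => i; exact: frob_liftX. Qed.

(* The universal polynomials of 2-typical Witt vectors, characterised by their
   ghost components; the first n ghost components determine them. *)
Fact add_poly_exists n : exists s : n.-tuple {mpoly int[n + n]},
  [forall k : 'I_n, ghost s k == ghost (lvars n n) k + ghost (rvars n n) k].
Proof.
apply: (dwork (fun k => ghost (lvars n n) k + ghost (rvars n n) k)) => k.
by rewrite rmorphD; apply: congr2D; [exact: lvars_frob|exact: rvars_frob].
Qed.

Fact mul_poly_exists n : exists s : n.-tuple {mpoly int[n + n]},
  [forall k : 'I_n, ghost s k == ghost (lvars n n) k * ghost (rvars n n) k].
Proof.
apply: (dwork (fun k => ghost (lvars n n) k * ghost (rvars n n) k)) => k.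
by rewrite rmorphM; apply: congr2M; [exact: lvars_frob|exact: rvars_frob].
Qed.

Fact opp_poly_exists n : exists s : n.-tuple {mpoly int[n]},
  [forall k : 'I_n, ghost s k == - ghost (vars n) k].
Proof.
apply: (dwork (fun k => - ghost (vars n) k)) => k.
by rewrite rmorphN; apply: congr2N; exact: vars_frob.
Qed.

Fact frob_poly_exists m n : exists s : n.-tuple {mpoly int[m]},
  [forall k : 'I_n, ghost s k == ghost (vars m) k.+1].
Proof.
apply: (dwork (fun k => ghost (vars m) k.+1)) => k.
by have [r ->] := vars_frob m k.+1; exists (r *+ 2); rewrite -mulrnA -expnS.
Qed.

Definition add_poly n := xchoose (add_poly_exists n).
Definition mul_poly n := xchoose (mul_poly_exists n).
Definition opp_poly n := xchoose (opp_poly_exists n).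
Definition frob_poly m n := xchoose (frob_poly_exists m n).

Definition wittvec (n : nat) (A : Type) := n.-tuple A.

HB.instance Definition _ n (A : choiceType) :=
  Choice.copy (wittvec n A) (n.-tuple A).

Section WittOps.
Variables (n : nat) (A : comPzRingType).
Implicit Types x y : wittvec n A.

Definition wzero : wittvec n A := [tuple 0 | i < n].
Definition wteich (a : A) : wittvec n A := [tuple if i == 0%N :> nat then a else 0 | i < n].
Definition wopp x : wittvec n A :=
  [tuple peval x (tnth (opp_poly n) i) | i < n].
Definition wadd x y : wittvec n A :=
  [tuple peval (x ++ y) (tnth (add_poly n) i) | i < n].
Definition wmul x y : wittvec n A :=
  [tuple peval (x ++ y) (tnth (mul_poly n) i) | i < n].
(* Frobenius; meaningful when m < n or m = 0. *)
Definition wfrob m x : wittvec m A :=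
  [tuple peval x (tnth (frob_poly n m) i) | i < m].
End WittOps.

Lemma map_evalP (B : comPzRingType) N p (s : p.-tuple {mpoly int[N]}) (v : seq B) :
  [tuple peval v (tnth s i) | i < p] = [tuple of map (peval v) s].
Proof. by apply: eq_from_tnth => i; rewrite tnth_mktuple tnth_map. Qed.

Lemma map_vars (B : comPzRingType) N p (v : seq B) (g : 'I_p -> 'I_N) :
  map (peval v) [seq 'X_(g i) | i : 'I_p] = [seq v`_(g i) | i : 'I_p].
Proof. by rewrite -map_comp; apply: eq_map => i /=; rewrite pevalX. Qed.

Lemma nth_image_ord (B : nmodType) p (x : p.-tuple B) : [seq x`_i | i : 'I_p] = x.
Proof.
apply: (@eq_from_nth _ 0); rewrite size_map size_enum_ord ?size_tuple // => i ip.
by rewrite (nth_image (fun i => x`_i) (Ordinal ip)).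
Qed.

Section WittGhost.
Variables (n : nat) (A : comPzRingType).
Implicit Types x y : wittvec n A.

Lemma ghost_wadd x y k : (k < n)%N ->
  ghost (wadd x y) k = ghost x k + ghost y k.
Proof.
move=> kn; rewrite /wadd map_evalP ghost_map.
have /forallP/(_ (Ordinal kn))/eqP -> := xchooseP (add_poly_exists n).
rewrite rmorphD /= -!ghost_map !map_vars.
by rewrite -{3}(nth_image_ord x) -{3}(nth_image_ord y); congr (ghost _ _ + ghost _ _);
  apply: eq_map => i; rewrite nth_cat size_tuple /= ?ltn_ord // ltnNge leq_addr addKn.
Qed.

Lemma ghost_wmul x y k : (k < n)%N ->
  ghost (wmul x y) k = ghost x k * ghost y k.
Proof.
move=> kn; rewrite /wmul map_evalP ghost_map.
have /forallP/(_ (Ordinal kn))/eqP -> := xchooseP (mul_poly_exists n).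
rewrite rmorphM /= -!ghost_map !map_vars.
by rewrite -{3}(nth_image_ord x) -{3}(nth_image_ord y); congr (ghost _ _ * ghost _ _);
  apply: eq_map => i; rewrite nth_cat size_tuple /= ?ltn_ord // ltnNge leq_addr addKn.
Qed.

Lemma ghost_wopp x k : (k < n)%N -> ghost (wopp x) k = - ghost x k.
Proof.
move=> kn; rewrite /wopp map_evalP ghost_map.
have /forallP/(_ (Ordinal kn))/eqP -> := xchooseP (opp_poly_exists n).
by rewrite rmorphN /= -ghost_map map_vars nth_image_ord.
Qed.

Lemma ghost_wfrob m x k : (k < m)%N -> ghost (wfrob m x) k = ghost x k.+1.
Proof.
move=> km; rewrite /wfrob map_evalP ghost_map.
have /forallP/(_ (Ordinal km))/eqP -> := xchooseP (frob_poly_exists n m).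
by rewrite -ghost_map map_vars nth_image_ord.
Qed.

Lemma ghost_wteich (a : A) k : (k < n)%N -> ghost (wteich n a) k = a ^+ (2 ^ k).
Proof.
move=> kn; rewrite /ghost big_ord_recl /= subn0 mulr1n.
have n0 : (0 < n)%N by case: n kn.
rewrite (nth_image _ (Ordinal n0)) /= big1 ?addr0 // => i _.
have ltin : (i.+1 < n)%N by rewrite (leq_ltn_trans _ kn).
rewrite /bump /= add1n (nth_image _ (Ordinal ltin)) /=.
by rewrite expr0n expn_eq0 /= mul0rn.
Qed.

Lemma ghost_wzero k : ghost (wzero n A) k = 0.
Proof.
rewrite /ghost big1 // => i _; suff -> : (wzero n A)`_i = 0.
  by rewrite expr0n expn_eq0 mul0rn.
have [lt_in|le_ni] := ltnP i n; first by rewrite (nth_image _ (Ordinal lt_in)).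
by rewrite nth_default // size_tuple.
Qed.

End WittGhost.

Section WittFunctor.
Variables (n : nat) (A B : comPzRingType) (f : {rmorphism A -> B}).
Implicit Types x y : wittvec n A.

Definition wmap x : wittvec n B := [tuple of map f x].

Lemma peval_map N (s : seq A) (p : {mpoly int[N]}) : peval (map f s) p = f (peval s p).
Proof.
rewrite /peval rmorph_sum; apply: eq_bigr => m _; rewrite rmorphMz rmorph_prod.
congr (_ *~ _); apply: eq_bigr => i _; rewrite rmorphXn.
have [ix|ix] := ltnP i (size s); first by rewrite (nth_map 0).
by rewrite !nth_default ?rmorph0 ?size_map.
Qed.

Lemma wmapD x y : wmap (wadd x y) = wadd (wmap x) (wmap y).
Proof.
by apply: eq_from_tnth => i; rewrite tnth_map !tnth_mktuple -map_cat peval_map.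
Qed.

Lemma wmapM x y : wmap (wmul x y) = wmul (wmap x) (wmap y).
Proof.
by apply: eq_from_tnth => i; rewrite tnth_map !tnth_mktuple -map_cat peval_map.
Qed.

Lemma wmapN x : wmap (wopp x) = wopp (wmap x).
Proof. by apply: eq_from_tnth => i; rewrite tnth_map !tnth_mktuple peval_map. Qed.

Lemma wmap0 : wmap (wzero n A) = wzero n B.
Proof. by apply: eq_from_tnth => i; rewrite tnth_map !tnth_mktuple rmorph0. Qed.

Lemma wmapT a : wmap (wteich n a) = wteich n (f a).
Proof.
by apply: eq_from_tnth => i; rewrite tnth_map !tnth_mktuple; case: ifP; rewrite ?rmorph0.
Qed.

End WittFunctor.

Definition ghost_injective n (P : comPzRingType) :=
  forall X Y : wittvec n P,
    (forall k, (k < n)%N -> ghost X k = ghost Y k) -> X = Y.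

Lemma witt_lift n (A : comPzRingType) (x y z : wittvec n A) :
  exists (P : comPzRingType) (f : {rmorphism P -> A}) (X Y Z : wittvec n P),
    ghost_injective n P /\ [/\ x = wmap f X, y = wmap f Y & z = wmap f Z].
Proof.
exists {mpoly int[n + (n + n)]}, (peval (x ++ (y ++ z))).
exists [tuple 'X_(lshift _ i) | i < n].
exists [tuple 'X_(rshift _ (lshift _ i)) | i < n].
exists [tuple 'X_(rshift _ (rshift _ i)) | i < n].
split; first exact: ghost_inj.
split; apply: eq_from_tnth => i;
  rewrite tnth_map tnth_mktuple [RHS]pevalX (tnth_nth 0).
- by rewrite nth_cat size_tuple /= ltn_ord.
- rewrite /= nth_cat size_tuple ltnNge leq_addr addKn.
  by rewrite nth_cat size_tuple ltn_ord.
- rewrite /= nth_cat size_tuple ltnNge leq_addr addKn.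
  by rewrite nth_cat size_tuple ltnNge leq_addr addKn.
Qed.

Section WittRing.
Variables (n : nat) (A : comPzRingType).
Implicit Types x y z : wittvec n A.

Fact waddA : associative (@wadd n A).
Proof.
move=> x y z; have [P [f [X [Y [Z [inj [-> -> ->]]]]]]] := witt_lift x y z.
rewrite -!wmapD; congr (wmap f _); apply: inj => k kn.
by rewrite (ghost_wadd _ _ kn) (ghost_wadd _ _ kn) (ghost_wadd _ _ kn) (ghost_wadd _ _ kn) addrA.
Qed.

Fact waddC : commutative (@wadd n A).
Proof.
move=> x y; have [P [f [X [Y [_ [inj [-> -> _]]]]]]] := witt_lift x y x.
rewrite -!wmapD; congr (wmap f _); apply: inj => k kn.
by rewrite (ghost_wadd _ _ kn) (ghost_wadd _ _ kn) addrC.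
Qed.

Fact wadd0 : left_id (wzero n A) (@wadd n A).
Proof.
move=> x; have [P [f [X [_ [_ [inj [-> _ _]]]]]]] := witt_lift x x x.
rewrite -(wmap0 n f) -!wmapD; congr (wmap f _); apply: inj => k kn.
by rewrite (ghost_wadd _ _ kn) ghost_wzero add0r.
Qed.

Fact waddN : left_inverse (wzero n A) (@wopp n A) (@wadd n A).
Proof.
move=> x; have [P [f [X [_ [_ [inj [-> _ _]]]]]]] := witt_lift x x x.
rewrite -(wmap0 n f) -wmapN -!wmapD; congr (wmap f _); apply: inj => k kn.
by rewrite (ghost_wadd _ _ kn) (ghost_wopp _ kn) ghost_wzero addNr.
Qed.

Fact wmulA : associative (@wmul n A).
Proof.
move=> x y z; have [P [f [X [Y [Z [inj [-> -> ->]]]]]]] := witt_lift x y z.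
rewrite -!wmapM; congr (wmap f _); apply: inj => k kn.
by rewrite (ghost_wmul _ _ kn) (ghost_wmul _ _ kn) (ghost_wmul _ _ kn) (ghost_wmul _ _ kn) mulrA.
Qed.

Fact wmulC : commutative (@wmul n A).
Proof.
move=> x y; have [P [f [X [Y [_ [inj [-> -> _]]]]]]] := witt_lift x y x.
rewrite -!wmapM; congr (wmap f _); apply: inj => k kn.
by rewrite (ghost_wmul _ _ kn) (ghost_wmul _ _ kn) mulrC.
Qed.

Fact wmul1 : left_id (wteich n 1) (@wmul n A).
Proof.
move=> x; have [P [f [X [_ [_ [inj [-> _ _]]]]]]] := witt_lift x x x.
rewrite -(rmorph1 f) -wmapT -!wmapM; congr (wmap f _); apply: inj => k kn.
by rewrite (ghost_wmul _ _ kn) (ghost_wteich _ kn) expr1n mul1r.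
Qed.

Fact wmulDl : left_distributive (@wmul n A) (@wadd n A).
Proof.
move=> x y z; have [P [f [X [Y [Z [inj [-> -> ->]]]]]]] := witt_lift x y z.
rewrite -!wmapD -!wmapM -!wmapD; congr (wmap f _); apply: inj => k kn.
by rewrite (ghost_wmul _ _ kn) (ghost_wadd _ _ kn) (ghost_wadd _ _ kn) (ghost_wmul _ _ kn) (ghost_wmul _ _ kn) mulrDl.
Qed.

HB.instance Definition _ :=
  GRing.isZmodule.Build (wittvec n A) waddA waddC wadd0 waddN.
HB.instance Definition _ :=
  GRing.Zmodule_isComPzRing.Build (wittvec n A) wmulA wmulC wmul1 wmulDl.

End WittRing.

(* [-1]_n is a unit of W_n(A), equal to its own inverse. *)
Lemma wteichM n (A : comPzRingType) (a b : A) :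
  wteich n a * wteich n b = wteich n (a * b).
Proof.
have [P [f [X [Y [_ [inj [Xa Yb _]]]]]]] :=
  witt_lift (wteich n a) (wteich n b) (wteich n a).
have [->|n0] := posnP n; first by rewrite tuple0 [RHS]tuple0.
have tE c Z : wteich n c = wmap f Z -> c = f Z`_0.
  move/(congr1 (fun t : n.-tuple A => tnth t (Ordinal n0))).
  by rewrite tnth_mktuple tnth_map (tnth_nth 0).
rewrite (tE _ _ Xa) (tE _ _ Yb) -rmorphM -!wmapT.
have -> : wmap f (wteich n X`_0) * wmap f (wteich n Y`_0) =
    wmul (wmap f (wteich n X`_0)) (wmap f (wteich n Y`_0)) by [].
rewrite -wmapM; congr (wmap f _); apply: inj => k kn.
by rewrite (ghost_wmul _ _ kn) !(ghost_wteich _ kn) exprMn.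
Qed.

Lemma wteichN1_sqr n (A : comPzRingType) :
  wteich n (-1) * wteich n (-1) = 1 :> wittvec n A.
Proof. by rewrite wteichM mulrNN mulr1. Qed.

(* W_n(A) for n : int, so that W_n(A) = 0 for n <= 0. *)
Definition wlen (n : int) : nat := if n is Posz m then m else 0%N.
Notation witt A n := (wittvec (wlen n) A).

Section WittMaps.
Variables (A : comPzRingType) (n : int).

Definition teich (a : A) : witt A n := wteich (wlen n) a.
Definition wittR (x : witt A (n + 1)) : witt A n := [tuple x`_i | i < wlen n].
Definition wittF (x : witt A (n + 1)) : witt A n := wfrob (wlen n) x.
Definition wittV (x : witt A n) : witt A (n + 1) :=
  [tuple if i : nat is j.+1 then x`_j else 0 | i < wlen (n + 1)].
End WittMaps.

(* The product of degrees p and q lands in every degree r equipped with a proof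
   of p + q = r. Equality on int being proof-irrelevant, this is one product
   E^p x E^q -> E^(p + q), and no casts between E^r and E^r' with r = r' are
   needed. *)
Record gradedRing := GradedRing {
  gr_sort :> int -> zmodType;
  gr_one : gr_sort 0;
  gr_mul : forall p q r : int, p + q = r -> gr_sort p -> gr_sort q -> gr_sort r;
  gr_mulA : forall (p q r pq qr s : int) (hpq : p + q = pq) (hqr : q + r = qr)
      (hl : pq + r = s) (hr : p + qr = s) x y z,
    gr_mul hl (gr_mul hpq x y) z = gr_mul hr x (gr_mul hqr y z);
  gr_mul1l : forall (p : int) (h : 0 + p = p) x, gr_mul h gr_one x = x;
  gr_mul1r : forall (p : int) (h : p + 0 = p) x, gr_mul h x gr_one = x;
  gr_mulDl : forall (p q r : int) (h : p + q = r) x x' y,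
    gr_mul h (x + x') y = gr_mul h x y + gr_mul h x' y;
  gr_mulDr : forall (p q r : int) (h : p + q = r) x y y',
    gr_mul h x (y + y') = gr_mul h x y + gr_mul h x y';
  gr_mulC : forall (p q r : int) (h : p + q = r) (h' : q + p = r) x y,
    gr_mul h x y = gr_mul h' y x *~ (-1) ^ (p * q)
}.

Record gradedHom (E E' : gradedRing) := GradedHom {
  gh_fun :> forall q : int, {additive E q -> E' q};
  gh_one : gh_fun 0 (gr_one E) = gr_one E';
  gh_mul : forall (p q r : int) (h : p + q = r) (x : E p) (y : E q),
    gh_fun r (gr_mul h x y) = gr_mul h (gh_fun p x) (gh_fun q y)
}.

(* The data of a 2-typical Witt complex, without the relations involving iota,
   which is defined from them. The maps R, F and V between the levels n and
   n + 1 are indexed by the lower level n. *)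
Record preWittComplex (A : comPzRingType) := PreWittComplex {
  wc_ring :> int -> gradedRing;
  wc_R : forall n : int, gradedHom (wc_ring (n + 1)) (wc_ring n);
  wc_le0 : forall n : int, n <= 0 -> forall (q : int) (x : wc_ring n q), x = 0;

  wc_lam : forall n : int, {additive witt A n -> wc_ring n 0};
  wc_lam1 : forall n : int, wc_lam n 1 = gr_one (wc_ring n);
  wc_lamM : forall (n : int) (h : 0 + 0 = 0 :> int) (a b : witt A n),
    wc_lam n (a * b) = gr_mul h (wc_lam n a) (wc_lam n b);
  wc_lamR : forall (n : int) (a : witt A (n + 1)),
    wc_lam n (wittR a) = wc_R n 0 (wc_lam (n + 1) a);

  wc_F : forall n : int, gradedHom (wc_ring (n + 1)) (wc_ring n);
  wc_FR : forall (n q : int) (x : wc_ring (n + 1 + 1) q),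
    wc_F n q (wc_R (n + 1) q x) = wc_R n q (wc_F (n + 1) q x);
  wc_lamF : forall (n : int) (a : witt A (n + 1)),
    wc_lam n (wittF a) = wc_F n 0 (wc_lam (n + 1) a);

  wc_V : forall n q : int, {additive wc_ring n q -> wc_ring (n + 1)%R q};
  wc_VR : forall (n q : int) (x : wc_ring (n + 1) q),
    wc_V n q (wc_R n q x) = wc_R (n + 1) q (wc_V (n + 1) q x);
  wc_VF : forall (n p q r : int) (h : p + q = r)
      (x : wc_ring n p) (y : wc_ring (n + 1) q),
    gr_mul h (wc_V n p x) y = wc_V n r (gr_mul h x (wc_F n q y));
  wc_lamV : forall (n : int) (a : witt A n),
    wc_lam (n + 1) (wittV a) = wc_V n 0 (wc_lam n a);
  wc_FV : forall (n q : int) (x : wc_ring n q), wc_F n q (wc_V n q x) = x *+ 2;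

  wc_d : forall n q : int, {additive wc_ring n q -> wc_ring n (q + 1)%R};
  wc_dR : forall (n q : int) (x : wc_ring (n + 1) q),
    wc_d n q (wc_R n q x) = wc_R n (q + 1) (wc_d (n + 1) q x);
  wc_dM : forall (n p q r : int) (h : p + q = r)
      (hl : (p + 1) + q = r + 1) (hr : p + (q + 1) = r + 1)
      (x : wc_ring n p) (y : wc_ring n q),
    wc_d n r (gr_mul h x y) =
      gr_mul hl (wc_d n p x) y + gr_mul hr x (wc_d n q y) *~ (-1) ^ p
}.

Section Iota.
Variables (A : comPzRingType) (E : preWittComplex A) (n : int).

Definition wc_dteich (a : A) : E n (0 + 1) := wc_d E n 0 (wc_lam E n (teich n a)).

(* d lambda[-1] / lambda[-1]; by wteichN1_sqr, [-1] is its own inverse. *)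
Definition wc_dlogN1 : E n (0 + 1) :=
  gr_mul (add0r (0 + 1)) (wc_lam E n (teich n (-1))) (wc_dteich (-1)).

Fact iota_degree (q : int) : (0 + 1) + q = q + 1.
Proof. by rewrite add0r addrC. Qed.

Definition wc_iota (q : int) (x : E n q) : E n (q + 1) :=
  gr_mul (iota_degree q) wc_dlogN1 x.
End Iota.

(* 2-typical Witt complexes over A. *)
Record wittComplex (A : comPzRingType) := WittComplex {
  wc_pre :> preWittComplex A;
  wc_FdV : forall (n q : int) (x : wc_pre n q),
    wc_F wc_pre n (q + 1) (wc_d wc_pre (n + 1) q (wc_V wc_pre n q x)) =
      wc_d wc_pre n q x + wc_iota x;
  wc_dd : forall (n q : int) (x : wc_pre n q),
    wc_d wc_pre n (q + 1) (wc_d wc_pre n q x) =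
      wc_d wc_pre n (q + 1) (wc_iota x);
  wc_diota : forall (n q : int) (x : wc_pre n q),
    wc_d wc_pre n (q + 1) (wc_iota x) = wc_iota (wc_d wc_pre n q x);
  wc_Fdteich : forall (n : int) (a : A),
    wc_F wc_pre n (0 + 1) (wc_dteich wc_pre (n + 1) a) =
      gr_mul (add0r (0 + 1)) (wc_lam wc_pre n (teich n a))
        (wc_dteich wc_pre n a)
}.

Record wittHom (A : comPzRingType) (E E' : wittComplex A) := WittHom {
  wh_fun :> forall n : int, gradedHom (E n) (E' n);
  wh_R : forall (n q : int) (x : E (n + 1) q),
    wh_fun n q (wc_R E n q x) = wc_R E' n q (wh_fun (n + 1) q x);
  wh_lam : forall (n : int) (a : witt A n),
    wh_fun n 0 (wc_lam E n a) = wc_lam E' n a;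
  wh_d : forall (n q : int) (x : E n q),
    wh_fun n (q + 1) (wc_d E n q x) = wc_d E' n q (wh_fun n q x);
  wh_F : forall (n q : int) (x : E (n + 1) q),
    wh_fun n q (wc_F E n q x) = wc_F E' n q (wh_fun (n + 1) q x);
  wh_V : forall (n q : int) (x : E n q),
    wh_fun (n + 1) q (wc_V E n q x) = wc_V E' n q (wh_fun n q x)
}.

(* Morphisms are equal when they agree pointwise. *)
Definition initial_wittComplex (A : comPzRingType) (E : wittComplex A) :=
  forall E' : wittComplex A, exists f : wittHom E E',
    forall (g : wittHom E E') (n q : int) (x : E n q), g n q x = f n q x.

(* Main.v *)
Require Import Defs.
From HB Require Import structures.
From mathcomp Require Import all_boot all_order all_algebra.
From mathcomp Require Import boolp.

(** A Witt complex over [A] is a model of a many-sorted equational theory, with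
    one sort for each pair (level, degree), so the initial object is the algebra
    of closed terms modulo the equations which hold in every Witt complex.
    Calling two terms equal when all Witt complexes give them the same value is
    legitimate because [Prop] is impredicative, and makes each axiom hold in the
    quotient for the reason that it holds in every Witt complex. *)

Set Implicit Arguments.
Unset Strict Implicit.
Unset Printing Implicit Defensive.

Import GRing.Theory.
Local Open Scope ring_scope.
Local Open Scope quotient_scope.

(** * Closed terms and their values in a Witt complex *)

Section InitialWittComplex.
Variable A : comPzRingType.
Implicit Types (n p q r : int) (W : wittComplex A).

(** The constructors range over integers, degree equalities and Witt vectors of [A], never over Witt
    complexes, so the quotient is small enough to carry a Witt complex itself. Signs, integer
    multiples and iota get no constructor, being expressible through the others. *)
Inductive term : int -> int -> Type :=
| TZero n q : term n q
| TOpp n q : term n q -> term n q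
| TAdd n q : term n q -> term n q -> term n q
| TOne n : term n 0
| TMul n p q r : p + q = r -> term n p -> term n q -> term n r
| TLam n : wittvec (wlen n) A -> term n 0
| TR n q : term (n + 1) q -> term n q
| TF n q : term (n + 1) q -> term n q
| TV n q : term n q -> term (n + 1) q
| TD n q : term n q -> term n (q + 1).

Fixpoint eval W n q (t : term n q) : W n q :=
  match t in term n q return W n q with
  | TZero _ _ => 0
  | TOpp _ _ s => - eval W s
  | TAdd _ _ s t => eval W s + eval W t
  | TOne n => gr_one (W n)
  | TMul _ _ _ _ h s t => gr_mul h (eval W s) (eval W t)
  | TLam n a => wc_lam W n a
  | TR n q s => wc_R W n q (eval W s)
  | TF n q s => wc_F W n q (eval W s)
  | TV n q s => wc_V W n q (eval W s)
  | TD n q s => wc_d W n q (eval W s)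
  end.

(** * The quotient of terms by the equations valid in all Witt complexes *)

Section Carrier.
Variables n q : int.

(** Classical equality and choice on terms, as required by the quotient and its section [repr]. *)
HB.instance Definition _ := gen_eqMixin (term n q).
HB.instance Definition _ := gen_choiceMixin (term n q).

Definition term_eq (s t : term n q) : bool :=
  `[< forall W, eval W s = eval W t >].

Lemma term_eq_refl : reflexive term_eq.
Proof. by move=> s; apply/asboolP. Qed.

Lemma term_eq_sym : symmetric term_eq.
Proof. by move=> s t; apply/asboolP/asboolP => st W; rewrite st. Qed.

Lemma term_eq_trans : transitive term_eq.
Proof.
by move=> t s u /asboolP st /asboolP tu; apply/asboolP => W; rewrite st tu.
Qed.

Canonical term_equiv :=
  EquivRel term_eq term_eq_refl term_eq_sym term_eq_trans.

Definition carrier := {eq_quot term_equiv}.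
HB.instance Definition _ := Choice.on carrier.
HB.instance Definition _ := EqQuotient.on carrier.

Definition class (t : term n q) : carrier := \pi_carrier t.

Lemma classK (x : carrier) : class (repr x) = x.
Proof. exact: reprK. Qed.

Definition qeval W (x : carrier) : W n q := eval W (repr x).

(** The term selected by [repr] is related to [t] by [term_eq], hence has the same value in [W]; so
    the choice of representative is harmless. *)
Lemma qeval_class W (t : term n q) : qeval W (class t) = eval W t.
Proof.
have /eqmodP/asboolP : repr (\pi_carrier t) = t %[mod carrier] by rewrite reprK.
exact.
Qed.

(** Representatives with equal values in every [W] are related by [term_eq]. The axioms below all
    follow this way: evaluate in an arbitrary [W] and quote its own axiom. *)
Lemma qeval_ext (x y : carrier) : (forall W, qeval W x = qeval W y) -> x = y.
Proof.
by move=> xy; rewrite -[x]reprK -[y]reprK; apply/eqmodP/asboolP.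
Qed.

End Carrier.

(** * Operations on classes and their compatibility with evaluation *)

Definition qzero n q : carrier n q := class (TZero n q).
Definition qopp n q (x : carrier n q) : carrier n q := class (TOpp (repr x)).
Definition qadd n q (x y : carrier n q) : carrier n q :=
  class (TAdd (repr x) (repr y)).
Definition qone n : carrier n 0 := class (TOne n).
Definition qmul n p q r (h : p + q = r) (x : carrier n p) (y : carrier n q) :
  carrier n r := class (TMul h (repr x) (repr y)).
Definition qlam n (a : wittvec (wlen n) A) : carrier n 0 := class (TLam a).
Definition qR n q (x : carrier (n + 1) q) : carrier n q := class (TR (repr x)).
Definition qF n q (x : carrier (n + 1) q) : carrier n q := class (TF (repr x)).
Definition qV n q (x : carrier n q) : carrier (n + 1) q := class (TV (repr x)).
Definition qd n q (x : carrier n q) : carrier n (q + 1) := class (TD (repr x)).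

Section QEval.
Variable W : wittComplex A.

Lemma qeval_zero n q : qeval W (qzero n q) = 0.
Proof. exact: qeval_class. Qed.
Lemma qeval_opp n q (x : carrier n q) : qeval W (qopp x) = - qeval W x.
Proof. exact: qeval_class. Qed.
Lemma qeval_add n q (x y : carrier n q) :
  qeval W (qadd x y) = qeval W x + qeval W y.
Proof. exact: qeval_class. Qed.
Lemma qeval_one n : qeval W (qone n) = gr_one (W n).
Proof. exact: qeval_class. Qed.
Lemma qeval_mul n p q r (h : p + q = r) (x : carrier n p) (y : carrier n q) :
  qeval W (qmul h x y) = gr_mul h (qeval W x) (qeval W y).
Proof. exact: qeval_class. Qed.
Lemma qeval_lam n (a : wittvec (wlen n) A) : qeval W (qlam a) = wc_lam W n a.
Proof. exact: qeval_class. Qed.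
Lemma qeval_R n q (x : carrier (n + 1) q) :
  qeval W (qR x) = wc_R W n q (qeval W x).
Proof. exact: qeval_class. Qed.
Lemma qeval_F n q (x : carrier (n + 1) q) :
  qeval W (qF x) = wc_F W n q (qeval W x).
Proof. exact: qeval_class. Qed.
Lemma qeval_V n q (x : carrier n q) : qeval W (qV x) = wc_V W n q (qeval W x).
Proof. exact: qeval_class. Qed.
Lemma qeval_d n q (x : carrier n q) : qeval W (qd x) = wc_d W n q (qeval W x).
Proof. exact: qeval_class. Qed.

Definition qevalE := (qeval_zero, qeval_opp, qeval_add, qeval_one, qeval_mul,
  qeval_lam, qeval_R, qeval_F, qeval_V, qeval_d).

End QEval.

(** * Additive groups of classes and additivity of the operations *)

Section CarrierZmodule.
Variables n q : int.

Fact qaddA : associative (@qadd n q).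
Proof. by move=> x y z; apply: qeval_ext => W; rewrite !qevalE addrA. Qed.
Fact qaddC : commutative (@qadd n q).
Proof. by move=> x y; apply: qeval_ext => W; rewrite !qevalE addrC. Qed.
Fact qadd0 : left_id (qzero n q) (@qadd n q).
Proof. by move=> x; apply: qeval_ext => W; rewrite !qevalE add0r. Qed.
Fact qaddN : left_inverse (qzero n q) (@qopp n q) (@qadd n q).
Proof. by move=> x; apply: qeval_ext => W; rewrite !qevalE addNr. Qed.

HB.instance Definition _ :=
  GRing.isZmodule.Build (carrier n q) qaddA qaddC qadd0 qaddN.

Fact qeval_is_additive W : zmod_morphism (@qeval n q W).
(* Subtraction of classes unfolds to [qadd x (qopp y)]. *)
Proof. by move=> x y; rewrite (qeval_add W x (qopp y)) qeval_opp. Qed.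

(** Carries evaluation through the generic group operations, in particular the signs in [gr_mulC]
    and [wc_dM] and the factor 2 in [wc_FV]. *)
HB.instance Definition _ W :=
  GRing.isZmodMorphism.Build (carrier n q) (W n q) (@qeval n q W)
    (qeval_is_additive W).

End CarrierZmodule.

Section Additivity.
Variables n q : int.

Fact qlam_is_additive : zmod_morphism (@qlam n).
Proof.
by move=> x y; apply: qeval_ext => W; rewrite raddfB /= !qevalE raddfB.
Qed.
HB.instance Definition _ :=
  GRing.isZmodMorphism.Build _ _ (@qlam n) qlam_is_additive.

Fact qR_is_additive : zmod_morphism (@qR n q).
Proof.
by move=> x y; apply: qeval_ext => W; rewrite raddfB /= !qevalE !raddfB.
Qed.
HB.instance Definition _ :=
  GRing.isZmodMorphism.Build _ _ (@qR n q) qR_is_additive.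

Fact qF_is_additive : zmod_morphism (@qF n q).
Proof.
by move=> x y; apply: qeval_ext => W; rewrite raddfB /= !qevalE !raddfB.
Qed.
HB.instance Definition _ :=
  GRing.isZmodMorphism.Build _ _ (@qF n q) qF_is_additive.

Fact qV_is_additive : zmod_morphism (@qV n q).
Proof.
by move=> x y; apply: qeval_ext => W; rewrite raddfB /= !qevalE !raddfB.
Qed.
HB.instance Definition _ :=
  GRing.isZmodMorphism.Build _ _ (@qV n q) qV_is_additive.

Fact qd_is_additive : zmod_morphism (@qd n q).
Proof.
by move=> x y; apply: qeval_ext => W; rewrite raddfB /= !qevalE !raddfB.
Qed.
HB.instance Definition _ :=
  GRing.isZmodMorphism.Build _ _ (@qd n q) qd_is_additive.

End Additivity.

(** * Graded rings of classes and the Witt complex they form *)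

Definition qring n : gradedRing.
Proof.
refine (@GradedRing (carrier n : int -> zmodType) (qone n) (@qmul n)
  _ _ _ _ _ _).
- by move=> *; apply: qeval_ext => W; rewrite !qevalE; apply: gr_mulA.
- by move=> *; apply: qeval_ext => W; rewrite !qevalE; apply: gr_mul1l.
- by move=> *; apply: qeval_ext => W; rewrite !qevalE; apply: gr_mul1r.
- by move=> *; apply: qeval_ext => W; rewrite raddfD /= !qevalE;
    apply: gr_mulDl.
- by move=> *; apply: qeval_ext => W; rewrite raddfD /= !qevalE;
    apply: gr_mulDr.
- by move=> p q r h h' x y; apply: qeval_ext => W;
    rewrite raddfMz /= !qevalE; apply: gr_mulC.
(* Transparent, so that the sorts of [qring n] reduce to [carrier n]. *)
Defined.

Definition qR_hom n : gradedHom (qring (n + 1)) (qring n).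
Proof.
refine (@GradedHom (qring (n + 1)) (qring n) (fun q => @qR n q) _ _).
- by apply: qeval_ext => W; rewrite !qevalE gh_one.
- by move=> *; apply: qeval_ext => W; rewrite !qevalE gh_mul.
Defined.

Definition qF_hom n : gradedHom (qring (n + 1)) (qring n).
Proof.
refine (@GradedHom (qring (n + 1)) (qring n) (fun q => @qF n q) _ _).
- by apply: qeval_ext => W; rewrite !qevalE gh_one.
- by move=> *; apply: qeval_ext => W; rewrite !qevalE gh_mul.
Defined.

Definition qpre : preWittComplex A.
Proof.
refine (@PreWittComplex A qring qR_hom _ (fun n => @qlam n) _ _ _
  qF_hom _ _ (fun n q => @qV n q) _ _ _ _ (fun n q => @qd n q) _ _).
(* There are many terms at a level [n <= 0], but each has value 0 in every [W], so they form a
   single class. *)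
- by move=> n n0 q x; apply: qeval_ext => W; rewrite raddf0; apply: wc_le0.
- by move=> n; apply: qeval_ext => W; rewrite !qevalE wc_lam1.
- by move=> n h a b; apply: qeval_ext => W; rewrite !qevalE; apply: wc_lamM.
- by move=> n a; apply: qeval_ext => W; rewrite !qevalE wc_lamR.
- by move=> n q x; apply: qeval_ext => W; rewrite !qevalE wc_FR.
- by move=> n a; apply: qeval_ext => W; rewrite !qevalE wc_lamF.
- by move=> n q x; apply: qeval_ext => W; rewrite !qevalE wc_VR.
- by move=> n p q r h x y; apply: qeval_ext => W; rewrite !qevalE wc_VF.
- by move=> n a; apply: qeval_ext => W; rewrite !qevalE wc_lamV.
- by move=> n q x; apply: qeval_ext => W; rewrite raddfMn /= !qevalE wc_FV.
- by move=> n q x; apply: qeval_ext => W; rewrite !qevalE wc_dR.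
- move=> n p q r h hl hr x y; apply: qeval_ext => W.
  by rewrite raddfD raddfMz /= !qevalE; apply: wc_dM.
Defined.

Lemma qeval_dteich W n (a : A) : qeval W (wc_dteich qpre n a) = wc_dteich W n a.
Proof. by rewrite !qevalE. Qed.

(** Iota is composed of products, [wc_lam] and [wc_d], all preserved by evaluation; hence the
    relations that mention it transfer too. *)
Lemma qeval_iota W n q (x : qpre n q) :
  qeval W (wc_iota x) = wc_iota (qeval W x).
Proof. by rewrite !qevalE. Qed.

Definition qcomplex : wittComplex A.
Proof.
refine (@WittComplex A qpre _ _ _ _).
- move=> n q x; apply: qeval_ext => W.
  by rewrite raddfD /= qeval_iota !qevalE wc_FdV.
- move=> n q x; apply: qeval_ext => W.
  by rewrite !qeval_d qeval_iota wc_dd.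
- move=> n q x; apply: qeval_ext => W.
  by rewrite qeval_d !qeval_iota qeval_d wc_diota.
- move=> n a; apply: qeval_ext => W.
  by rewrite qeval_F qeval_mul !qeval_dteich qeval_lam wc_Fdteich.
Defined.

(** * Initiality: evaluation is the only morphism *)

Definition qeval_gradedHom W n : gradedHom (qring n) (W n) :=
  @GradedHom (qring n) (W n) (fun q => @qeval n q W)
    (@qeval_one W n) (@qeval_mul W n).

Definition qeval_hom W : wittHom qcomplex W :=
  @WittHom A qcomplex W (qeval_gradedHom W) (@qeval_R W) (@qeval_lam W)
    (@qeval_d W) (@qeval_F W) (@qeval_V W).

(** Each constructor of terms is an operation that morphisms preserve, so induction on [t] leaves
    [g] no freedom. This is the uniqueness half. *)
Lemma wittHom_class W (g : wittHom qcomplex W) n q (t : term n q) :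
  g n q (class t) = eval W t.
Proof.
elim: t => {n q} [n q|n q s IH|n q s IHs t IHt|n|n p q r h s IHs t IHt|n a
  |n q s IH|n q s IH|n q s IH|n q s IH] /=.
- exact: raddf0.
(* The operation acts on [repr (class s)], which may differ from [s] as a term but has the same
   values; likewise in the cases below. *)
- have -> : class (TOpp s) = - class s.
    by apply: qeval_ext => W'; rewrite raddfN /= !qeval_class.
  by rewrite -IH -raddfN.
- have -> : class (TAdd s t) = class s + class t.
    by apply: qeval_ext => W'; rewrite raddfD /= !qeval_class.
  by rewrite -IHs -IHt -raddfD.
- exact: (gh_one (g n)).
- have -> : class (TMul h s t) = qmul h (class s) (class t).
    by apply: qeval_ext => W'; rewrite qeval_mul !qeval_class.
  by rewrite -IHs -IHt; apply: (gh_mul (g n)).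
- exact: (wh_lam g).
- have -> : class (TR s) = qR (class s).
    by apply: qeval_ext => W'; rewrite qeval_R !qeval_class.
  by rewrite -IH -(wh_R g).
- have -> : class (TF s) = qF (class s).
    by apply: qeval_ext => W'; rewrite qeval_F !qeval_class.
  by rewrite -IH -(wh_F g).
- have -> : class (TV s) = qV (class s).
    by apply: qeval_ext => W'; rewrite qeval_V !qeval_class.
  by rewrite -IH -(wh_V g).
- have -> : class (TD s) = qd (class s).
    by apply: qeval_ext => W'; rewrite qeval_d !qeval_class.
  by rewrite -IH -(wh_d g).
Qed.

End InitialWittComplex.

Theorem theorem3p1 (A : comPzRingType) :
  exists E : wittComplex A, initial_wittComplex E.
Proof.
exists (qcomplex A) => W; exists (qeval_hom W) => g n q x.
(* Every element is the class of its representative, so [g] must agree with evaluation at [x]. *)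
by rewrite -[x]classK wittHom_class; apply/esym/qeval_class.
Qed.
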